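(* The following $13$ relations hold for all $n\ge 0$: \begin{enumerate} \item $\mathcal{P}_{4n+1}=\mathcal{P}_{2n+1}$ \item $\mathcal{P}_{8n+4}=\mathcal{P}_{8n+3}+\mathcal{P}_{4n+3}-\mathcal{P}_{4n+2}$ \item $\mathcal{P}_{16n}=\mathcal{P}_{8n}$ \item $\mathcal{P}_{16n+2}=\mathcal{P}_{8n+2}$ \item $\mathcal{P}_{16n+6}=-\mathcal{P}_{16n+3}+\mathcal{P}_{8n+3}+3\mathcal{P}_{8n+2}+\mathcal{P}_{4n+3}-2\mathcal{P}_{4n+2}-\mathcal{P}_{2n+1}$ \item $\mathcal{P}_{16n+7}=-\mathcal{P}_{16n+3}+\mathcal{P}_{8n+3}+3\mathcal{P}_{8n+2}+2\mathcal{P}_{4n+3}-3\mathcal{P}_{4n+2}-\mathcal{P}_{2n+1}$ \item $\mathcal{P}_{16n+8}=\mathcal{P}_{8n+2}+\mathcal{P}_{4n+3}-\mathcal{P}_{2n+1}$ \item $\mathcal{P}_{16n+10}=\mathcal{P}_{8n+2}+\mathcal{P}_{4n+3}-\mathcal{P}_{2n+1}$ \item $\mathcal{P}_{16n+11}=-\mathcal{P}_{16n+3}+3\mathcal{P}_{8n+2}+\mathcal{P}_{4n+3}-2\mathcal{P}_{2n+1}$ \item $\mathcal{P}_{16n+14}=\mathcal{P}_{16n+3}+\mathcal{P}_{8n+7}-\mathcal{P}_{8n+3}-\mathcal{P}_{8n+2}-\mathcal{P}_{4n+3}+3\mathcal{P}_{4n+2}-\mathcal{P}_{2n+1}$ \item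 $\mathcal{P}_{16n+15}=\mathcal{P}_{16n+3}+2\mathcal{P}_{8n+7}-3\mathcal{P}_{8n+6}-2\mathcal{P}_{8n+3}+6\mathcal{P}_{4n+2}-3\mathcal{P}_{2n+1}$ \item $\mathcal{P}_{32n+3}=\mathcal{P}_{8n+3}$ \item $\mathcal{P}_{32n+19}=-\mathcal{P}_{16n+3}+\mathcal{P}_{8n+3}+3\mathcal{P}_{8n+2}+2\mathcal{P}_{4n+3}-3\mathcal{P}_{4n+2}-\mathcal{P}_{2n+1}$ \end{enumerate} These relations generate the $\mathbb{Z}$-module spanned by the $2$-kernel of $(\mathcal{P}_n)_{n\ge0}$, in the sense that, by means of them, every sequence $(\mathcal{P}_{2^e n+c})_{n\ge 0}$ with $e\ge 0$, $0\le c<2^e$ is a $\mathbb{Z}$-linear combination of the finitely many such sequences with $e\le 4$.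
   Context: The infinite Thue--Morse word is $t=\lim_{n\to\infty} m^n(0)=0110100110010110\cdots$, where $m$ is the morphism $0\mapsto 01$, $1\mapsto 10$. $T_n$ denotes the set of (finite, contiguous) factors of $t$ of length $n$. For words $u,v$, $|u|_v$ is the number of occurrences of $v$ as a factor of $u$. Two words $u,v\in\{0,1\}^*$ are $2$-abelian equivalent, $u\equiv_2 v$, if their prefixes of length $1$ agree, their suffixes of length $1$ agree, and $|u|_w=|v|_w$ for every word $w$ of length $2$. (The empty word forms its own class.) $\mathcal{P}_n:=\#(T_n/{\equiv_2})$; the sequence starts $1,2,4,6,8,6,8,10,8,6,\dots$. The $2$-kernel of a sequence $(a(n))_{n\ge 0}$ is the set of subsequences $\{(a(2^e n+c))_{n\ge 0} \mid e\ge 0,\ 0\le c<2^e\}$. *)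

(* Defs.v *)
From mathcomp Require Import all_boot all_algebra.
From mathcomp Require Import boolp.

Set Implicit Arguments.
Unset Strict Implicit.
Unset Printing Implicit Defensive.

Import GRing.Theory.
Local Open Scope ring_scope.

(* Words over {0,1} are bit sequences, false standing for the letter 0 and
   true for the letter 1. *)
Definition morph_letter (b : bool) : bitseq :=
  if b then [:: true; false] else [:: false; true].

Definition morph (w : bitseq) : bitseq := flatten (map morph_letter w).

(* The limit of the words m^k(0): each m^k(0) is a prefix of m^(k+1)(0) and has
   length 2^k, so that the letter i of the limit can be read off m^i(0); see
   [iter_morphE]. *)
Definition thue_morse (i : nat) : bool := nth false (iter i morph [:: false]) i.

Lemma morph_cat u v : morph (u ++ v) = morph u ++ morph v.
Proof. by rewrite /morph map_cat flatten_cat. Qed.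

Lemma size_iter_morph k : size (iter k morph [:: false]) = (2 ^ k)%N.
Proof.
have size_morph w : size (morph w) = (2 * size w)%N.
  elim: w => [|b w IHw] //.
  by rewrite -cat1s morph_cat !size_cat IHw mulnDr; case: b.
by elim: k => [|k IHk] //=; rewrite size_morph IHk expnS.
Qed.

Lemma prefix_iter_morph k l :
  (k <= l)%N -> prefix (iter k morph [:: false]) (iter l morph [:: false]).
Proof.
have step j :
    prefix (iter j morph [:: false]) (iter j.+1 morph [:: false]).
  elim: j => [|j /prefixP[s Es]] //.
  by rewrite [X in prefix _ X]iterS [in X in prefix _ X]Es morph_cat; apply: prefix_prefix.
elim: l => [|l IHl]; first by rewrite leqn0 => /eqP->.
rewrite leq_eqVlt => /predU1P[->|]; first exact: prefix_refl.
by rewrite ltnS => /IHl /prefix_trans; apply.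
Qed.

Lemma iter_morphE k :
  iter k morph [:: false] = mkseq thue_morse (2 ^ k).
Proof.
apply: (@eq_from_nth _ false) => [|i].
  by rewrite size_mkseq size_iter_morph.
rewrite size_iter_morph => lt_i; rewrite nth_mkseq // /thue_morse.
have [/prefix_iter_morph|/ltnW/prefix_iter_morph] := leqP k i.
  by case/prefixP => s ->; rewrite nth_cat size_iter_morph lt_i.
by case/prefixP => s ->; rewrite nth_cat size_iter_morph ltn_expl.
Qed.

Definition tm_factor (w : bitseq) : Prop :=
  exists i : nat, w = [seq thue_morse j | j <- iota i (size w)].

Definition tm_factors (n : nat) : {set n.-tuple bool} :=
  [set w : n.-tuple bool | `[< tm_factor w >]].

(* |u|_v, counting (possibly overlapping) occurrences by starting position *)
Definition occ (u v : bitseq) : nat :=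
  count (fun i => prefix v (drop i u)) (iota 0 (size u).+1).

(* [take 1 u] and [drop (size u).-1 u] are the prefix and the suffix of length
   1 of a nonempty word u; both are empty when u is. *)
Definition abelian2_equiv (u v : bitseq) : bool :=
  [&& take 1 u == take 1 v,
      drop (size u).-1 u == drop (size v).-1 v
    & [forall w : 2.-tuple bool, occ u w == occ v w]].

Lemma abelian2_equivP : equivalence_rel abelian2_equiv.
Proof.
move=> u v w; split; first by rewrite /abelian2_equiv !eqxx; apply/forallP.
case/and3P=> /eqP Euv1 /eqP Euv2 /forallP Euv; rewrite /abelian2_equiv Euv1 Euv2.
by congr [&& _, _ & _]; apply: eq_forallb => x; rewrite (eqP (Euv x)).
Qed.

(* P_n = #(T_n / =_2) *)
Definition tm_complexity2 (n : nat) : nat :=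
  #|equivalence_partition (fun u v : n.-tuple bool => abelian2_equiv u v)
                          (tm_factors n)|.

(* The relations for a sequence f with values in an arbitrary Z-module, so that
   their formal consequences can be expressed by quantifying over f. *)
Definition kernel_relations (M : zmodType) (f : nat -> M) : Prop :=
  forall n : nat,
  f (4 * n + 1)%N = f (2 * n + 1)%N /\
  f (8 * n + 4)%N = f (8 * n + 3)%N + f (4 * n + 3)%N - f (4 * n + 2)%N /\
  f (16 * n)%N = f (8 * n)%N /\
  f (16 * n + 2)%N = f (8 * n + 2)%N /\
  f (16 * n + 6)%N =
    - f (16 * n + 3)%N + f (8 * n + 3)%N + f (8 * n + 2)%N *+ 3
    + f (4 * n + 3)%N - f (4 * n + 2)%N *+ 2 - f (2 * n + 1)%N /\
  f (16 * n + 7)%N =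
    - f (16 * n + 3)%N + f (8 * n + 3)%N + f (8 * n + 2)%N *+ 3
    + f (4 * n + 3)%N *+ 2 - f (4 * n + 2)%N *+ 3 - f (2 * n + 1)%N /\
  f (16 * n + 8)%N = f (8 * n + 2)%N + f (4 * n + 3)%N - f (2 * n + 1)%N /\
  f (16 * n + 10)%N = f (8 * n + 2)%N + f (4 * n + 3)%N - f (2 * n + 1)%N /\
  f (16 * n + 11)%N =
    - f (16 * n + 3)%N + f (8 * n + 2)%N *+ 3 + f (4 * n + 3)%N
    - f (2 * n + 1)%N *+ 2 /\
  f (16 * n + 14)%N =
    f (16 * n + 3)%N + f (8 * n + 7)%N - f (8 * n + 3)%N - f (8 * n + 2)%N
    - f (4 * n + 3)%N + f (4 * n + 2)%N *+ 3 - f (2 * n + 1)%N /\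
  f (16 * n + 15)%N =
    f (16 * n + 3)%N + f (8 * n + 7)%N *+ 2 - f (8 * n + 6)%N *+ 3
    - f (8 * n + 3)%N *+ 2 + f (4 * n + 2)%N *+ 6 - f (2 * n + 1)%N *+ 3 /\
  f (32 * n + 3)%N = f (8 * n + 3)%N /\
  f (32 * n + 19)%N =
    - f (16 * n + 3)%N + f (8 * n + 3)%N + f (8 * n + 2)%N *+ 3
    + f (4 * n + 3)%N *+ 2 - f (4 * n + 2)%N *+ 3 - f (2 * n + 1)%N.

(* (f (2^e n + c))_n is the Z-linear combination with coefficients a i j of the
   sequences (f (2^i n + j))_n with i <= 4 and j < 2^i. *)
Definition kernel_lincomb (M : zmodType) (f : nat -> M) (e c : nat)
    (a : nat -> nat -> int) : Prop :=
  forall n : nat,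
  f (2 ^ e * n + c)%N =
    \sum_(i < 5) \sum_(j < 2 ^ i) f (2 ^ i * n + j)%N *~ a i j.

(* Main.v *)
Require Import Defs.
From mathcomp Require Import all_boot all_algebra.
From mathcomp Require Import boolp zify.
Local Open Scope ring_scope.

Set Implicit Arguments.
Unset Strict Implicit.
Unset Printing Implicit Defensive.

Import GRing.Theory.

(** Let C(i) be the number of j < i with t_j <> t_(j+1). Then t_i is the parity
    of C(i), and since t_(2k) and t_(2k+1) always differ while t_(2k+1) and
    t_(2k+2) differ exactly when t_k and t_(k+1) agree, C satisfies

      C(i) + C(floor(i/2)) = i                              ([changes_half]).

    The equal neighbours 00 and 11 of t start at odd positions and alternate,
    beginning with 11. So a factor of length m+1 at position i contains
    e = C(floor((i+m)/2)) - C(floor(i/2)) equal pairs, and its numbers of 00 and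
    of 11 depend only on e, on its first letter and, when e is odd, on the
    parity of i. For words of a given length the first letter and these two
    numbers determine the class ([abelian2_equivE], [equiv_key_tm_word]).

    For each l the increments C(j+l) - C(j) fill an interval [lo(l), hi(l)], and
    each value occurs with both parities of C(j). The equation for C turns into
    lo(m) = m - hi(ceil(m/2)) and hi(m) = m - lo(floor(m/2))
    ([change_range_unfold]). With l = floor(m/2) and l' = ceil(m/2), the values
    of e come from [lo(l), hi(l)] for i even and from [lo(l'), hi(l')] for i
    odd. An even e is counted once and an odd e once for each interval that
    contains it; with the two first letters this gives

      P_(m+1) = 2 (1 + hi(l') - lo(l) + ceil(hi(l)/2) - floor(lo(l')/2))

    ([tm_complexity2_range]). Unfolding the recurrences, both sides of each of
    the 13 relations become expressions in n and in lo and hi at n and n+1.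
    Since lo <= hi and both grow by 0 or 1 from n to n+1, the relations follow
    by linear arithmetic with halves ([tm_complexity2_kernel_relations]).

    For the generation statement, the relations express f(16k+s), for s <> 3,
    by terms f(2^i k + r) with i < 4 and by f(16k+3), and the last two
    relations express f(32k+3) and f(32k+19) by terms f(2^i k + r) with i <= 4.
    Substituting k = 2^w n + q lowers the exponent of every subsequence in
    question until it is at most 4 ([spanned_kernel]). *)

Local Open Scope nat_scope.

(** * The number of letter changes *)

Lemma nth_morph w i (b : bool) :
  i < size w -> nth false (morph w) (2 * i + b) = nth false w i (+) b.
Proof.
elim: w i => [|x w IHw] [|i] //=.
  by case: x; case: (b).
rewrite ltnS => /IHw <-.
rewrite -[x :: w]cat1s morph_cat nth_cat mulnS.
have -> : size (morph [:: x]) = 2 by case: x.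
by rewrite -addnA addKn.
Qed.

Lemma thue_morse_half i : thue_morse i = thue_morse i./2 (+) odd i.
Proof.
rewrite -{1}[i]odd_double_half addnC -mul2n.
have lti : i./2 < 2 ^ i./2 by exact: ltn_expl.
have := @nth_morph (iter i./2 morph [:: false]) i./2 (odd i).
rewrite -iterS !iter_morphE size_mkseq !nth_mkseq //; first exact.
by rewrite expnS; case: (odd i); lia.
Qed.

Fixpoint changes (i : nat) : nat :=
  if i is j.+1 then changes j + (thue_morse j != thue_morse j.+1) else 0.

Lemma thue_morse_changes i : thue_morse i = odd (changes i).
Proof.
elim: i => [|i IHi] /=; first by [].
by rewrite oddD -IHi; case: (thue_morse i); case: (thue_morse i.+1).
Qed.

(** The self-similarity that drives everything: position j contributes to
    exactly one side, since t changes after every even position, and after the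
    odd position 2k+1 exactly when it does not change after k. *)
Lemma changes_half i : changes i + changes i./2 = i.
Proof.
elim: i => [|i IHi]; first by [].
rewrite [changes i.+1]/= (thue_morse_half i) (thue_morse_half i.+1) oddS.
have [odd_i|even_i] := boolP (odd i).
  have -> : i.+1./2 = i./2.+1 by lia.
  rewrite [changes i./2.+1]/=.
  by case: (thue_morse i./2); case: (thue_morse i./2.+1) => /=; lia.
have -> : i.+1./2 = i./2 by lia.
by case: (thue_morse i./2) => /=; lia.
Qed.

Lemma changes_bounds i l : changes i <= changes (i + l) <= changes i + l.
Proof.
elim: l => [|l IHl]; first by rewrite !addn0 leqnn.
by rewrite addnS /=; case: (_ != _); lia.
Qed.

(** * The class of a Thue-Morse factor *)

Lemma occ_cons x u v : occ (x :: u) v = prefix v (x :: u) + occ u v.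
Proof.
rewrite /occ -[iota 0 _]/(0 :: iota (1 + 0) (size u).+1).
by rewrite iotaDl -[0 :: _]cat1s count_cat count_map /= addn0.
Qed.

Definition pair_count (x y : bool) (u : bitseq) := occ u [:: x; y].

Lemma pair_count_cons2 x y a b s :
  pair_count x y [:: a, b & s] =
  ((x == a) && (y == b)) + pair_count x y (b :: s).
Proof. by rewrite /pair_count occ_cons /= prefix0s andbT. Qed.

Lemma pair_count1 x y a : pair_count x y [:: a] = 0.
Proof. by rewrite /pair_count /occ /= !andbF. Qed.

Lemma pair_count_total a s :
  pair_count false false (a :: s) + pair_count true true (a :: s)
  + (pair_count false true (a :: s) + pair_count true false (a :: s)) = size s.
Proof.
elim: s a => [|b s IHs] a; first by rewrite !pair_count1.
by rewrite !pair_count_cons2 /= -(IHs b); case: a; case: b => /=; lia.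
Qed.

Lemma pair_count_ends a s :
  pair_count false true (a :: s) + a =
  pair_count true false (a :: s) + last a s.
Proof.
elim: s a => [|b s IHs] a; first by rewrite !pair_count1.
have := IHs b.
by rewrite !pair_count_cons2 /=; case: a; case: b => /=; lia.
Qed.

(** The total number of equal neighbours is recorded along with the number of
    11, because it is the quantity read off from [changes]. *)
Definition equiv_key (u : bitseq) : bool * nat * nat :=
  (head false u, pair_count false false u + pair_count true true u,
   pair_count true true u).

(** For a fixed length the key determines the sum of the numbers of 01 and 10,
    and their difference is last letter minus first letter; the parity of the
    sum then yields the last letter, hence each of the two numbers. *)
Lemma abelian2_equivE u v :
  0 < size u -> size u = size v ->
  abelian2_equiv u v = (equiv_key u == equiv_key v).
Proof.
case: u v => [//|a s] [//|b r] _ [eq_sz].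
have drop_last c q : drop (size (c :: q)).-1 (c :: q) = [:: last c q].
  by rewrite lastI size_rcons -cats1 drop_size_cat.
rewrite /abelian2_equiv !drop_last /= !take0 !eqseq_cons !eqxx !andbT.
rewrite /equiv_key !xpair_eqE /=.
have Ta := pair_count_total a s; have Tb := pair_count_total b r.
have Ea := pair_count_ends a s; have Eb := pair_count_ends b r.
apply/and3P/andP.
  case=> /eqP <- _ /forallP occE; rewrite eqxx /=.
  have e00 := eqP (occE [tuple false; false]).
  have e11 := eqP (occE [tuple true; true]).
  by rewrite /pair_count /= in e00 e11 *; rewrite e00 e11.
case=> /andP[/eqP eab /eqP e0] /eqP e1; subst b.
have last_eq : last a s = last a r.
  by case: (last a s) (last a r) Ea Eb => [] []; lia.
split; rewrite ?last_eq ?eqxx //.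
rewrite last_eq in Ea.
apply/forallP => w.
have -> : tval w = [:: tnth w ord0; tnth w (lift ord0 ord0)].
  case: w => [[|x [|y [|]]] //= ?].
apply/eqP; rewrite -!/(pair_count _ _ _).
by case: (tnth w _); case: (tnth w _); lia.
Qed.

Definition tm_word i n : bitseq := [seq thue_morse j | j <- iota i n].

(** Equal neighbours start at the positions 2k+1 where t changes after k, and
    the changes of t go alternately up, giving 11, and down, giving 00. Thus
    the first C(k) equal pairs contain ceil(C(k)/2) times 11. *)
Lemma tm_word_pairs i m :
  pair_count true true (tm_word i m.+1) + uphalf (changes i./2)
    = uphalf (changes (i + m)./2) /\
  pair_count false false (tm_word i m.+1) + (changes i./2)./2
    = (changes (i + m)./2)./2.
Proof.
elim: m i => [|m IHm] i; first by rewrite !addn0 !pair_count1.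
have [E1 E0] := IHm i.+1.
rewrite addSnnS in E1 E0.
have -> : tm_word i m.+2 =
  [:: thue_morse i, thue_morse i.+1 & tm_word i.+2 m] by [].
rewrite !pair_count_cons2.
have -> : thue_morse i.+1 :: tm_word i.+2 m = tm_word i.+1 m.+1 by [].
rewrite -E1 -E0.
rewrite (thue_morse_half i) (thue_morse_half i.+1) oddS.
have [odd_i|even_i] := boolP (odd i).
  have -> : i.+1./2 = i./2.+1 by lia.
  have := thue_morse_changes i./2.
  have /= := thue_morse_changes i./2.+1.
  by case: (thue_morse i./2); case: (thue_morse i./2.+1) => /=; lia.
have -> : i.+1./2 = i./2 by lia.
by case: (thue_morse i./2).
Qed.

(** The key of a factor with first letter [a], position of parity [r] and [e]
    equal pairs. For [e] odd the first equal pair is in the majority, and it is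
    11 exactly when [a] and [r] agree. *)
Definition factor_key (a r : bool) (e : nat) : bool * nat * nat :=
  (a, e, e./2 + (odd e && (a == r))).

Lemma equiv_key_tm_word i m :
  equiv_key (tm_word i m.+1) =
  factor_key (thue_morse i) (odd i) (changes (i + m)./2 - changes i./2).
Proof.
have [E1 E0] := tm_word_pairs i m.
have mono : changes i./2 <= changes (i + m)./2.
  have -> : (i + m)./2 = i./2 + ((i + m)./2 - i./2) by lia.
  by have /andP[] := changes_bounds i./2 ((i + m)./2 - i./2).
have t_i := thue_morse_changes i; have half_i := changes_half i.
rewrite /equiv_key /factor_key; congr (_, _, _); first by lia.
have -> : (thue_morse i == odd i) = ~~ odd (changes i./2) by lia.
by lia.
Qed.

(** * The interval of change counts in windows of given length *)

(** Attainment with both parities of [changes j] replaces closure of the factors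
    under exchange of the letters: flipping this parity complements the window
    and keeps its changes. Having it in the definition lets one induction prove
    both facts. *)
Definition change_range (l lo hi : nat) : Prop :=
  [/\ lo <= hi,
      forall j, changes j + lo <= changes (j + l) <= changes j + hi
    & forall (c : bool) e, lo <= e <= hi ->
        exists2 j, odd (changes j) = c & changes (j + l) = changes j + e].

Lemma change_range0 : change_range 0 0 0.
Proof.
split=> // [j|c e]; first by rewrite !addn0 leqnn.
by rewrite leqn0 => /eqP->; exists c; [case: c | rewrite !addn0].
Qed.

Lemma change_range1 : change_range 1 0 1.
Proof.
split=> // [j|c e]; first by rewrite addn0 changes_bounds.
(* t starts with 0110100, with windows 01, 11, 10 and 00 at 0, 1, 2 and 5. *)
by case: e => [|[|]] // _; case: c; [exists 1 | exists 5 | exists 2 | exists 0].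
Qed.

(** A window of length l+d extends one of length l and has at most d more
    changes, so the extreme counts move by at most d. For d = 0 this is
    uniqueness of the endpoints. *)
Lemma change_range_step l d lo hi lo' hi' :
  change_range l lo hi -> change_range (l + d) lo' hi' ->
  lo <= lo' <= lo + d /\ hi <= hi' <= hi + d.
Proof.
move=> [le bd at_] [le' bd' at_'].
have [|j1 _ e1] := at_ false lo; first by rewrite leqnn.
have [|j2 _ e2] := at_ false hi; first by rewrite leqnn le.
have [|j3 _ e3] := at_' false lo'; first by rewrite leqnn.
have [|j4 _ e4] := at_' false hi'; first by rewrite leqnn le'.
have step j := changes_bounds (j + l) d.
move: (step j1) (step j2) (step j3) (step j4); rewrite -!addnA.
by move: (bd' j1) (bd' j2) (bd j3) (bd j4); lia.
Qed.

Lemma change_range_le l lo hi : change_range l lo hi -> hi <= l.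
Proof.
case=> le _ /(_ false hi) [|j _ e]; first by rewrite le leqnn.
by have := changes_bounds j l; lia.
Qed.

(** By [changes_half], the window of length m at i has m minus the changes of
    the window between floor(i/2) and floor((i+m)/2), whose length is
    floor(m/2) for i even and ceil(m/2) for i odd. The two intervals obtained
    overlap or are adjacent, so their union is again an interval. *)
Lemma change_range_unfold m lo hi lo' hi' :
  change_range m./2 lo hi -> change_range (uphalf m) lo' hi' ->
  change_range m (m - hi') (m - lo).
Proof.
move=> R R'; have le_hi := change_range_le R; have le_hi' := change_range_le R'.
have := R'; rewrite uphalf_half addnC => /(change_range_step R)[le_lo le_hihi'].
case: R R' => le bd at_ [le' bd' at_'].
split=> [|i|c e le_e]; first by lia.
  move: (changes_half i) (changes_half (i + m)) (bd i./2) (bd' i./2).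
  have [odd_i|even_i] := boolP (odd i).
    have -> : (i + m)./2 = i./2 + uphalf m by lia.
    by lia.
  have -> : (i + m)./2 = i./2 + m./2 by lia.
  by lia.
(* Even positions reach the counts down to m - hi, odd ones the count m - hi'
   that may remain below; C(2j+1) and C(j) have opposite parities. *)
have [le_ehi|lt_hie] := leqP (m - hi) e.
  have [|j cj ej] := at_ c (m - e); first by lia.
  move: (changes_half (2 * j)) (changes_half (2 * j + m)).
  have -> : (2 * j)./2 = j by lia.
  have -> : (2 * j + m)./2 = j + m./2 by lia.
  by move=> E1 E2; exists (2 * j); lia.
have [|j cj ej] := at_' (~~ c) (m - e); first by lia.
move: (changes_half (2 * j).+1) (changes_half ((2 * j).+1 + m)).
have -> : ((2 * j).+1)./2 = j by lia.
have -> : ((2 * j).+1 + m)./2 = j + uphalf m by lia.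
by move=> E1 E2; exists (2 * j).+1; lia.
Qed.

Lemma change_range_exists m : exists r, change_range m r.1 r.2.
Proof.
elim/ltn_ind: m => -[|[|m]] IHm; first by exists (0, 0); exact: change_range0.
  by exists (0, 1); exact: change_range1.
have [|r R] := IHm m.+2./2; first by lia.
have [|r' R'] := IHm (uphalf m.+2); first by lia.
by exists (m.+2 - r'.2, m.+2 - r.1); apply: change_range_unfold R R'.
Qed.

(** * Counting the classes *)

Lemma card_equivalence_partition_keys (T : finType) (K : eqType) (R : rel T)
    (f : T -> K) (D : {set T}) (L : seq K) :
    {in D &, forall x y, R x y = (f x == f y)} -> uniq L ->
    (forall k, reflect (exists2 x, x \in D & f x = k) (k \in L)) ->
  #|equivalence_partition R D| = size L.
Proof.
move=> Rf uL LP; pose fiber k := [set y in D | f y == k].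
have <- : size (map fiber L) = size L by rewrite size_map.
have /card_uniqP <- : uniq (map fiber L).
  rewrite map_inj_in_uniq // => k k' /LP[x Dx <-] _ /setP/(_ x).
  by rewrite !inE Dx eqxx /= => /esym/eqP.
apply: eq_card => B; apply/imsetP/mapP => [[x Dx ->]|[k /LP[x Dx <-] ->]].
  exists (f x); first by apply/LP; exists x.
  apply/setP => y; rewrite !inE; apply: andb_id2l => Dy.
  by rewrite Rf // eq_sym.
exists x => //; apply/setP => y; rewrite !inE; apply: andb_id2l => Dy.
by rewrite Rf // eq_sym.
Qed.

Lemma count_iota_odd lo hi N :
  lo <= hi ->
  count (fun e => odd e && (lo <= e <= hi)) (iota 0 N) =
  (minn N hi.+1)./2 - (minn N lo)./2.
Proof.
move=> le_hi; elim: N => [|N IHN]; first by rewrite !min0n.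
rewrite -addn1 iotaD count_cat IHN /= add0n addn0.
by case: (boolP (odd N)) => oN; lia.
Qed.

Lemma count_iota_even lo hi N :
  lo <= hi ->
  count (fun e => ~~ odd e && (lo <= e <= hi)) (iota 0 N) =
  uphalf (minn N hi.+1) - uphalf (minn N lo).
Proof.
move=> le_hi; elim: N => [|N IHN]; first by rewrite !min0n.
rewrite -addn1 iotaD count_cat IHN /= add0n addn0.
by case: (boolP (odd N)) => oN; lia.
Qed.

Lemma count_split_parity (a b : pred nat) s :
  count (fun e => if odd e then a e else b e) s =
  count (fun e => odd e && a e) s + count (fun e => ~~ odd e && b e) s.
Proof.
by elim: s => //= e s ->; rewrite addnACA; case: (odd e); rewrite ?addn0.
Qed.

Lemma half_double_add j (q : bool) m : (2 * j + q + m)./2 = j + (m + q)./2.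
Proof. by case: q; lia. Qed.

(** The keys are counted by pairs (r, e), with r the parity of the position. For
    e even both values of r give the same key, represented by r = false; such e
    range over [lo, hi'], the union of the two intervals. *)
Lemma tm_complexity2_range m lo hi lo' hi' :
  change_range m./2 lo hi -> change_range (uphalf m) lo' hi' ->
  tm_complexity2 m.+1 = 2 * (1 + hi' - lo + uphalf hi - lo'./2).
Proof.
move=> R R'.
have := R'; rewrite uphalf_half addnC => /(change_range_step R)[le_lo le_hi].
case: R R' => le bd at_ [le' bd' at_'].
pose ok (p : bool * nat) :=
  if p.1 then odd p.2 && (lo' <= p.2 <= hi')
  else if odd p.2 then lo <= p.2 <= hi else lo <= p.2 <= hi'.
pose pairs := [seq p <- allpairs pair [:: false; true] (iota 0 hi'.+1) | ok p].
have pairsE (p : bool * nat) : (p \in pairs) = ok p.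
  rewrite mem_filter andb_idr // => ok_p; apply/allpairsP.
  exists (p.1, p.2).
  split; [by case: (p.1) | | exact: surjective_pairing].
  rewrite mem_iota; move: ok_p; rewrite /ok /=.
  by case: (p.1); case: (odd p.2) => /=; lia.
pose L := [seq factor_key a p.1 p.2 | a <- [:: false; true], p <- pairs].
have szL : size L = 2 * (1 + hi' - lo + uphalf hi - lo'./2).
  rewrite size_allpairs; congr (_ * _).
  (* The bound is made opaque so that simplification does not unfold iota. *)
  have [N defN] : exists N, N = hi'.+1 by exists hi'.+1.
  rewrite size_filter -defN /= cats0 count_cat !count_map.
  have le_lohi' : lo <= hi' by lia.
  move: (count_split_parity (fun e => lo <= e <= hi) (fun e => lo <= e <= hi')).
  move/(_ (iota 0 N)); rewrite count_iota_odd // count_iota_even //.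
  rewrite -/(count (preim (pair false) ok) _) => ->.
  move: (count_iota_odd N le').
  rewrite -/(count (preim (pair true) ok) _) => ->.
  by rewrite defN; lia.
rewrite -szL.
apply: (card_equivalence_partition_keys
  (f := fun w : m.+1.-tuple bool => equiv_key w)).
- by move=> u v _ _; apply: abelian2_equivE; rewrite !size_tuple.
- apply: allpairs_uniq => //.
    apply: filter_uniq; apply: allpairs_uniq; rewrite ?iota_uniq //.
    by move=> [? ?] [? ?].
  move=> x y /allpairsP[[a1 [r1 e1]] [_ p1 ->]].
  move=> /allpairsP[[a2 [r2 e2]] [_ p2 ->]].
  move: p1 p2; rewrite !pairsE /ok /factor_key /=.
  move=> ok1 ok2 [-> eq_e eq_11]; subst e2.
  suff -> : r1 = r2 by [].
  move: ok1 ok2 eq_11.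
  by case: r1; case: r2 => //; case: (a2); case: (odd e1) => //=; lia.
move=> k; apply: (iffP allpairsP) => [[[a [r e]]]|] /=.
  rewrite pairsE => -[_ ok_e ->].
  (* q is the parity of a position that realises e: forced for e odd, and for
     e even chosen according to the interval that contains e. *)
  pose q := if odd e then r else hi < e.
  have [j odd_j diff_j] : exists2 j, odd (changes j) = a (+) q &
      changes (j + (m + q)./2) = changes j + e.
    rewrite /q; move: ok_e; rewrite /ok /=.
    case: (odd e); case: (r) => /= ok_e.
    - by rewrite addn1; apply: at_'; lia.
    - by rewrite addn0; apply: at_; lia.
    - by [].
    case: ltnP => le_e; first by rewrite addn1; apply: at_'; lia.
    by rewrite addn0; apply: at_; lia.
  have sz_w : size (tm_word (2 * j + q) m.+1) == m.+1.
    by rewrite size_map size_iota.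
  exists (Tuple sz_w).
    by rewrite inE; apply/asboolP; exists (2 * j + q); rewrite size_tuple.
  rewrite /= equiv_key_tm_word thue_morse_half thue_morse_changes.
  have -> : (2 * j + q)./2 = j.
    have := half_double_add j q 0; rewrite addn0 add0n => ->.
    by case: (q); rewrite addn0.
  have -> : odd (2 * j + q) = q by rewrite oddD mul2n odd_double; case: (q).
  rewrite half_double_add.
  rewrite odd_j diff_j addKn addbK /factor_key.
  by rewrite /q; case: (odd e).
case=> w; rewrite inE => /asboolP[i ->] <-; rewrite size_tuple.
rewrite -/(tm_word i m.+1) equiv_key_tm_word.
set e := changes _ - _.
exists (thue_morse i, (odd i && odd e, e)) => /=; split.
- by case: (thue_morse i).
- rewrite pairsE /ok /= /e.
  move: (bd i./2) (bd' i./2).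
  have [odd_i|even_i] := boolP (odd i).
    have -> : (i + m)./2 = i./2 + uphalf m by lia.
    by rewrite /=; case: (odd _) => /=; lia.
  have -> : (i + m)./2 = i./2 + m./2 by lia.
  by rewrite /=; case: (odd _) => /=; lia.
by rewrite /factor_key; case: (odd e); rewrite ?andbT.
Qed.

(** Everything that the relations use about t, with lo and hi as functions. *)
Lemma complexity_recurrences :
  exists lo hi : nat -> nat,
  [/\ forall l, lo l <= hi l,
      forall l, lo l <= lo (l + 1) <= lo l + 1 /\
                hi l <= hi (l + 1) <= hi l + 1,
      forall m, lo m + hi (uphalf m) = m /\ hi m + lo m./2 = m
    & forall m, tm_complexity2 m.+1 + 2 * (lo m./2 + (lo (uphalf m))./2) =
        2 * (1 + hi (uphalf m) + uphalf (hi m./2))].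
Proof.
have [range rangeP] := choice change_range_exists.
exists (fun l => (range l).1), (fun l => (range l).2).
have lohi l : (range l).1 <= (range l).2 by case: (rangeP l).
have le_l l := change_range_le (rangeP l).
split=> // [l|m|m].
- exact: change_range_step (rangeP l) (rangeP (l + 1)).
- have := change_range_unfold (rangeP m./2) (rangeP (uphalf m)).
  rewrite -[m in change_range m]addn0 => /(change_range_step (rangeP m)).
  by move: (le_l m./2) (le_l (uphalf m)) (lohi m./2) (lohi (uphalf m)); lia.
have := rangeP (uphalf m); rewrite {1}uphalf_half addnC.
move=> /(change_range_step (rangeP m./2)).
rewrite (tm_complexity2_range (rangeP m./2) (rangeP (uphalf m))) /=.
by move: (lohi m./2) (lohi (uphalf m)); lia.
Qed.

(** * The thirteen relations *)

(** Each relation lists the instances of the recurrences that bring its two sides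
    down to lo and hi at n and n+1: Rd n j unfolds lo and hi at dn+j, and Pd n j
    evaluates the complexity at dn+j+1. *)
Lemma tm_complexity2_kernel_relations :
  kernel_relations (fun n : nat => (tm_complexity2 n)%:Z%R).
Proof.
have [lo [hi [lohi step rec cplx]]] := complexity_recurrences.
(* All arguments are written in the shape d * n + j, even for d = 1 or j = 0, so
   that different instances share the same terms. *)
have base n : [/\ lo (1 * n + 0) <= hi (1 * n + 0),
    lo (1 * n + 1) <= hi (1 * n + 1),
    lo (1 * n + 0) <= lo (1 * n + 1) <= lo (1 * n + 0) + 1
  & hi (1 * n + 0) <= hi (1 * n + 1) <= hi (1 * n + 0) + 1].
  by rewrite !lohi mul1n addn0; case: (step n).
have halves c d n j : d = c.*2 ->
    (d * n + j)./2 = c * n + j./2 /\ uphalf (d * n + j) = c * n + uphalf j.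
  by move=> ->; lia.
have range_at c d n j : d = c.*2 ->
    lo (d * n + j) + hi (c * n + uphalf j) = d * n + j /\
    hi (d * n + j) + lo (c * n + j./2) = d * n + j.
  by move=> /(halves c d n j)[<- <-]; exact: rec.
have complexity_at c d n j : d = c.*2 ->
    tm_complexity2 (d * n + j.+1)
    + 2 * (lo (c * n + j./2) + (lo (c * n + uphalf j))./2) =
    2 * (1 + hi (c * n + uphalf j) + uphalf (hi (c * n + j./2))).
  by move=> /(halves c d n j)[<- <-]; rewrite addnS; exact: cplx.
have R2 n j := range_at 1 2 n j erefl.
have R4 n j := range_at 2 4 n j erefl.
have R8 n j := range_at 4 8 n j erefl.
have R16 n j := range_at 8 16 n j erefl.
have P2 n j := complexity_at 1 2 n j erefl.
have P4 n j := complexity_at 2 4 n j erefl.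
have P8 n j := complexity_at 4 8 n j erefl.
have P16 n j := complexity_at 8 16 n j erefl.
have P32 n j := complexity_at 16 32 n j erefl.
move=> n /=.
split.
  by move: (base n) (R2 n 0) (P4 n 0) (P2 n 0);
    rewrite /=; lia.
split.
  by move: (base n) (R2 n 0) (R2 n 1) (R4 n 1) (R4 n 2) (P8 n 3) (P8 n 2)
    (P4 n 2) (P4 n 1); rewrite /=; lia.
split.
  (* The formula for the complexity needs a positive length. *)
  case: n => [//|n]; rewrite ![_ * n.+1]mulnSr.
  by move: (base n) (R2 n 1) (R2 n 2) (R4 n 3) (R4 n 4) (R8 n 7) (R8 n 8)
    (P16 n 15) (P8 n 7); rewrite /=; lia.
split.
  by move: (base n) (R2 n 0) (R2 n 1) (R4 n 0) (R4 n 1) (R8 n 0) (R8 n 1)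
    (P16 n 1) (P8 n 1); rewrite /=; lia.
split.
  by move: (base n) (R2 n 0) (R2 n 1) (R4 n 0) (R4 n 1) (R4 n 2) (R8 n 1)
    (R8 n 2) (R8 n 3) (P16 n 5) (P16 n 2) (P8 n 2) (P8 n 1) (P4 n 2) (P4 n 1)
    (P2 n 0); rewrite /=; lia.
split.
  by move: (base n) (R2 n 0) (R2 n 1) (R4 n 0) (R4 n 1) (R4 n 2) (R8 n 1)
    (R8 n 3) (P16 n 6) (P16 n 2) (P8 n 2) (P8 n 1) (P4 n 2) (P4 n 1) (P2 n 0);
    rewrite /=; lia.
split.
  by move: (base n) (R2 n 0) (R2 n 1) (R4 n 0) (R4 n 1) (R4 n 2) (R8 n 3)
    (R8 n 4) (P16 n 7) (P8 n 1) (P4 n 2) (P2 n 0);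
    rewrite /=; lia.
split.
  by move: (base n) (R2 n 0) (R2 n 1) (R2 n 2) (R4 n 0) (R4 n 1) (R4 n 2)
    (R4 n 3) (R8 n 4) (R8 n 5) (P16 n 9) (P8 n 1) (P4 n 2) (P2 n 0);
    rewrite /=; lia.
split.
  by move: (base n) (R2 n 0) (R2 n 1) (R2 n 2) (R4 n 0) (R4 n 1) (R4 n 2)
    (R4 n 3) (R8 n 1) (R8 n 5) (P16 n 10) (P16 n 2) (P8 n 1) (P4 n 2)
    (P2 n 0); rewrite /=; lia.
split.
  by move: (base n) (R2 n 0) (R2 n 1) (R2 n 2) (R4 n 0) (R4 n 1) (R4 n 3)
    (R4 n 4) (R8 n 1) (R8 n 6) (R8 n 7) (P16 n 13) (P16 n 2) (P8 n 6) (P8 n 2)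
    (P8 n 1) (P4 n 2) (P4 n 1) (P2 n 0);
    rewrite /=; lia.
split.
  by move: (base n) (R2 n 0) (R2 n 1) (R2 n 2) (R4 n 0) (R4 n 1) (R4 n 2)
    (R4 n 3) (R4 n 4) (R8 n 1) (R8 n 7) (P16 n 14) (P16 n 2) (P8 n 6) (P8 n 5)
    (P8 n 2) (P4 n 1) (P2 n 0);
    rewrite /=; lia.
split.
  by move: (base n) (R2 n 0) (R2 n 1) (R4 n 0) (R4 n 1) (R8 n 0) (R8 n 1)
    (R16 n 1) (P32 n 2) (P8 n 2); rewrite /=; lia.
by move: (base n) (R2 n 0) (R2 n 1) (R2 n 2) (R4 n 0) (R4 n 1) (R4 n 2)
  (R4 n 3) (R8 n 1) (R8 n 4) (R8 n 5) (R16 n 9) (P32 n 18) (P16 n 2)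
  (P8 n 2) (P8 n 1) (P4 n 2) (P4 n 1) (P2 n 0); rewrite /=; lia.
Qed.

(** * Generation of the kernel *)

Local Open Scope ring_scope.

(** The sequence transformer [g] is applied to a sequence satisfying the
    relations over an arbitrary Z-module, and the coefficients must not depend
    on it: this is formal derivability from the relations. *)
Definition spanned (g : forall M : zmodType, (nat -> M) -> nat -> M) : Prop :=
  exists a : nat -> nat -> int,
    forall (M : zmodType) (f : nat -> M), kernel_relations f ->
    forall n, g M f n =
      \sum_(i < 5) \sum_(j < 2 ^ i) f (2 ^ i * n + j)%N *~ a i j.

Lemma spanned_eq g h :
  (forall (M : zmodType) (f : nat -> M), kernel_relations f -> g M f =1 h M f) ->
  spanned h -> spanned g.
Proof. by move=> gh [a ha]; exists a => M f fP n; rewrite gh // ha. Qed.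

Lemma spannedD g h :
  spanned g -> spanned h -> spanned (fun M f n => g M f n + h M f n).
Proof.
move=> [a ga] [b hb]; exists (fun i j => a i j + b i j) => M f fP n.
rewrite ga // hb // -big_split; apply: eq_bigr => i _.
by rewrite -big_split; apply: eq_bigr => j _; rewrite mulrzDr.
Qed.

Lemma spannedN g : spanned g -> spanned (fun M f n => - g M f n).
Proof.
move=> [a ga]; exists (fun i j => - a i j) => M f fP n.
rewrite ga // -sumrN; apply: eq_bigr => i _.
by rewrite -sumrN; apply: eq_bigr => j _; rewrite mulrNz.
Qed.

Lemma spannedB g h :
  spanned g -> spanned h -> spanned (fun M f n => g M f n - h M f n).
Proof. by move=> Sg Sh; apply: spannedD => //; apply: spannedN. Qed.

Lemma spannedMn g k : spanned g -> spanned (fun M f n => g M f n *+ k).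
Proof.
move=> [a ga]; exists (fun i j => a i j *+ k) => M f fP n.
rewrite ga // -sumrMnl; apply: eq_bigr => i _.
rewrite -sumrMnl; apply: eq_bigr => j _.
by rewrite pmulrn -mulrzA -mulr_natr natz.
Qed.

Definition kernel_elt (e c : nat) (M : zmodType) (f : nat -> M) (n : nat) : M :=
  f (2 ^ e * n + c)%N.

Lemma spanned_low e c : (e < 5)%N -> (c < 2 ^ e)%N -> spanned (kernel_elt e c).
Proof.
move=> lt_e lt_c; exists (fun i j => ((i == e) && (j == c))%:Z) => M f _ n.
rewrite (bigD1 (Ordinal lt_e)) //= (bigD1 (Ordinal lt_c)) //= !eqxx mulr1z.
rewrite big1 => [|j /negbTE ne_j]; last first.
  by have -> : (j == c :> nat) = false by []; rewrite mulr0z.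
rewrite addr0 big1 ?addr0 // => i /negbTE ne_i; apply: big1 => j _.
by have -> : (i == e :> nat) = false by []; rewrite mulr0z.
Qed.

(** Decomposes a right-hand side of a relation into its terms, which are
    expected among the hypotheses. *)
Ltac span_combination :=
  repeat first [ apply: spannedB | apply: spannedD | apply: spannedN
               | apply: spannedMn | assumption ].

(** The sequence f(16k+3) has no relation of its own, but its two halves, for k
    even and for k odd, are reduced by the last two relations. *)
Lemma spanned_16mul_add3 (k : nat -> nat) (b : bool) :
    (forall i r, (i < 5)%N -> (r < 2 ^ i)%N ->
       spanned (fun M f n => f (2 ^ i * k n + r)%N)) ->
  spanned (fun M f n => f (16 * (2 * k n + b) + 3)%N).
Proof.
move=> low.
have S2_1 : spanned (fun M f n => f (2 * k n + 1)%N) := low 1 1 isT isT.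
have S4_2 : spanned (fun M f n => f (4 * k n + 2)%N) := low 2 2 isT isT.
have S4_3 : spanned (fun M f n => f (4 * k n + 3)%N) := low 2 3 isT isT.
have S8_2 : spanned (fun M f n => f (8 * k n + 2)%N) := low 3 2 isT isT.
have S8_3 : spanned (fun M f n => f (8 * k n + 3)%N) := low 3 3 isT isT.
have S16_3 : spanned (fun M f n => f (16 * k n + 3)%N) := low 4 3 isT isT.
have E3 n : (16 * (2 * k n + false) + 3 = 32 * k n + 3)%N by lia.
have E19 n : (16 * (2 * k n + true) + 3 = 32 * k n + 19)%N by lia.
case: b; (eapply spanned_eq => [M f fP n|]).
- rewrite E19.
  have [_ [_ [_ [_ [_ [_ [_ [_ [_ [_ [_ [_ R]]]]]]]]]]]] := fP (k n); exact: R.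
- by span_combination.
- rewrite E3.
  have [_ [_ [_ [_ [_ [_ [_ [_ [_ [_ [_ [R _]]]]]]]]]]]] := fP (k n); exact: R.
by span_combination.
Qed.

(** The first two relations, written modulo 16. *)
Lemma kernel_relations_16 (M : zmodType) (f : nat -> M) k :
  kernel_relations f ->
  [/\ f (16 * k + 1)%N = f (8 * k + 1)%N /\ f (16 * k + 5)%N = f (8 * k + 3)%N,
      f (16 * k + 9)%N = f (8 * k + 5)%N /\ f (16 * k + 13)%N = f (8 * k + 7)%N,
      f (16 * k + 4)%N = f (16 * k + 3)%N + f (8 * k + 3)%N - f (8 * k + 2)%N
    & f (16 * k + 12)%N = f (16 * k + 11)%N + f (8 * k + 7)%N - f (8 * k + 6)%N].
Proof.
move=> fP.
have R1 j a b : a = (4 * j + 1)%N -> b = (2 * j + 1)%N -> f a = f b.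
  by move=> -> ->; case: (fP j).
have R2 j a b c d : a = (8 * j + 4)%N -> b = (8 * j + 3)%N ->
    c = (4 * j + 3)%N -> d = (4 * j + 2)%N -> f a = f b + f c - f d.
  by move=> -> -> -> ->; case: (fP j) => _ [].
split; [split | split | |].
- by apply: (R1 (4 * k)%N); lia.
- by apply: (R1 (4 * k + 1)%N); lia.
- by apply: (R1 (4 * k + 2)%N); lia.
- by apply: (R1 (4 * k + 3)%N); lia.
- by apply: (R2 (2 * k)%N); lia.
by apply: (R2 (2 * k + 1)%N); lia.
Qed.

(** Every residue s modulo 16 except 3 has a relation for f(16k+s) in terms of
    f(16k+3) and of the values f(2^i k + r) with i < 4; the residue 12 goes
    through 11. *)
Lemma spanned_16mul_add (k : nat -> nat) s :
    (forall i r, (i < 4)%N -> (r < 2 ^ i)%N ->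
       spanned (fun M f n => f (2 ^ i * k n + r)%N)) ->
    spanned (fun M f n => f (16 * k n + 3)%N) ->
  (s < 16)%N -> spanned (fun M f n => f (16 * k n + s)%N).
Proof.
move=> low S16_3 lt_s.
have S2_1 : spanned (fun M f n => f (2 * k n + 1)%N) := low 1 1 isT isT.
have S4_2 : spanned (fun M f n => f (4 * k n + 2)%N) := low 2 2 isT isT.
have S4_3 : spanned (fun M f n => f (4 * k n + 3)%N) := low 2 3 isT isT.
have S8_0 : spanned (fun M f n => f (8 * k n + 0)%N) := low 3 0 isT isT.
have S8_1 : spanned (fun M f n => f (8 * k n + 1)%N) := low 3 1 isT isT.
have S8_2 : spanned (fun M f n => f (8 * k n + 2)%N) := low 3 2 isT isT.
have S8_3 : spanned (fun M f n => f (8 * k n + 3)%N) := low 3 3 isT isT.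
have S8_5 : spanned (fun M f n => f (8 * k n + 5)%N) := low 3 5 isT isT.
have S8_6 : spanned (fun M f n => f (8 * k n + 6)%N) := low 3 6 isT isT.
have S8_7 : spanned (fun M f n => f (8 * k n + 7)%N) := low 3 7 isT isT.
have S16_11 : spanned (fun M f n => f (16 * k n + 11)%N).
  eapply spanned_eq => [M f fP n|].
    by have [_ [_ [_ [_ [_ [_ [_ [_ [R _]]]]]]]]] := fP (k n); exact: R.
  by span_combination.
have [->|s_neq0] := eqVneq s 0%N.
  apply: spanned_eq S8_0 => M f fP n.
  by rewrite !addn0; have [_ [_ []]] := fP (k n).
(* In each goal the relation instantiates the combination still to be found,
   which is then decomposed. *)
do 16?[case: s lt_s s_neq0 => [|s] // lt_s s_neq0] => //.
all: eapply spanned_eq; [move=> M f fP n | ].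
all: first
  [ have [R1 [R2 [R3 [R4 [R5 [R6 [R7 [R8 [R9 [R10 [R11 _]]]]]]]]]]] :=
      fP (k n);
    have [[R16_1 R16_5] [R16_9 R16_13] R16_4 R16_12] :=
      kernel_relations_16 (k n) fP;
    by match goal with R : ?lhs = _ |- ?lhs = _ => exact: R end
  | span_combination ].
Qed.

(** For e >= 5, write c = 16q + s. With k = 2^(e-4) n + q, the argument 2^e n +
    c is 16k + s, and f(2^i k + r) has exponent e - 4 + i < e for i < 4. For s
    = 3, one more binary digit is split off q, and i <= 4 still lowers e. *)
Lemma spanned_kernel e c : (c < 2 ^ e)%N -> spanned (kernel_elt e c).
Proof.
elim/ltn_ind: e c => e IHe c lt_c.
have [lt_e|le_e] := ltnP e 5; first exact: spanned_low.
have low w q i r : (w + i < e)%N -> (q < 2 ^ w)%N -> (r < 2 ^ i)%N ->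
    spanned (fun M f n => f (2 ^ i * (2 ^ w * n + q) + r)%N).
  move=> lt_wi lt_q lt_r.
  have lt_qr : (2 ^ i * q + r < 2 ^ (w + i))%N by rewrite expnD; nia.
  apply: spanned_eq (IHe _ lt_wi _ lt_qr) => M f _ n.
  by rewrite /kernel_elt expnD mulnDr mulnA addnA [(2 ^ i * _)%N]mulnC.
have expE i : (i <= e)%N -> (2 ^ e = 2 ^ i * 2 ^ (e - i))%N.
  by move=> le_i; rewrite -expnD subnKC.
have [E4 E5] := (expE 4%N (ltnW le_e), expE 5%N le_e).
pose q := (c %/ 16)%N; pose q' := (c %/ 32)%N.
have lt_q : (q < 2 ^ (e - 4))%N by rewrite ltn_divLR // mulnC -E4.
have lt_q' : (q' < 2 ^ (e - 5))%N by rewrite ltn_divLR // mulnC -E5.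
have S3 : spanned (fun M f n => f (16 * (2 ^ (e - 4) * n + q) + 3)%N).
  have def_q : q = (2 * q' + odd q)%N by rewrite /q' /q; lia.
  have exp_q : (2 ^ (e - 4) = 2 * 2 ^ (e - 5))%N.
    by rewrite -expnS; congr (_ ^ _)%N; lia.
  apply: spanned_eq
    (@spanned_16mul_add3 (fun n => 2 ^ (e - 5) * n + q')%N (odd q) _).
    by move=> M f _ n; congr (f (16 * _ + 3)%N); rewrite exp_q {1}def_q; lia.
  by move=> i r lt_i lt_r; apply: low => //; lia.
apply: spanned_eq
  (@spanned_16mul_add (fun n => 2 ^ (e - 4) * n + q)%N (c %% 16) _ S3 _).
- by move=> M f _ n; rewrite /kernel_elt E4; congr f; rewrite /q; lia.
- by move=> i r lt_i lt_r; apply: low => //; lia.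
by rewrite ltn_mod.
Qed.

(* The last conjunct expresses "by means of them": the linear combination is
   a formal consequence of the 13 relations, valid for every sequence that
   satisfies them. *)
Theorem theorem1p1 :
  kernel_relations (fun n : nat => (tm_complexity2 n)%:Z) /\
  forall e c : nat, (c < 2 ^ e)%N ->
    exists a : nat -> nat -> int,
      kernel_lincomb (fun n : nat => (tm_complexity2 n)%:Z) e c a /\
      forall (M : zmodType) (f : nat -> M),
        kernel_relations f -> kernel_lincomb f e c a.
Proof.
have tm_rel := tm_complexity2_kernel_relations.
split=> // e c /spanned_kernel[a aP]; exists a; split; last exact: aP.
exact: (aP _ _ tm_rel).
Qed.
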